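(* Let $\alpha\in(0,1)$ be fixed. Consider testing $$H_0: Y\sim\mathcal N_n(0,\Sigma_n)\quad\text{against}\quad H_1^n:\ \exists\,1\le k\le\lfloor\lambda_n^{-1}\rfloor,\ \exists\delta\in\mathbb R,\ |\delta|\ge\Delta_n:\ Y\sim\mathcal N_n(\delta\mathbf 1_{I_k},\Sigma_n),$$ where $I_k=[(k-1)\lambda_n,k\lambda_n)$. Let $$\Phi_n^{\mathrm d}(Y)=\begin{cases}1&\text{if } \sup_{1\le k\le\lfloor\lambda_n^{-1}\rfloor}\frac{|\mathbf 1_{I_k}^T\Sigma_n^{-1}Y|}{\sqrt{\tilde\sigma_k}}>c_{\alpha,n},\\0&\text{else,}\end{cases}\qquad \tilde\sigma_k=\mathbf 1_{I_k}^T\Sigma_n^{-1}\mathbf 1_{I_k},\qquad c_{\alpha,n}=\sqrt{2\log\frac{2}{\alpha\lambda_n}} .$$ Then $\tilde\alpha(\Phi_n^{\mathrm d})\le\alpha$ for all $n\in\mathbb N$, and $$\tilde\beta(\Phi_n^{\mathrm d})\le\mathbb P\Bigl[|Z|>\Delta_n\inf_{1\le k\le\lfloor\lambda_n^{-1}\rfloor}\sqrt{\tilde\sigma_k}-c_{\alpha,n}\Bigr],$$ where $Z\sim\mathcal N(0,1)$.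
   Context: For each $n$, $\Sigma_n\in\mathbb R^{n\times n}$ is a known positive definite covariance matrix, namely that of $n$ consecutive samples of a stationary Gaussian process; $\lambda_n\in(0,1)$ is a known length and $\Delta_n>0$. For an interval $I\subset[0,1]$, $\mathbf 1_I\in\mathbb R^n$ is the vector with entries $\mathbf 1_I(i)=1$ if $\frac in\in I$ and $0$ otherwise, $1\le i\le n$. The vectors $\mathbf 1_{I_k}$ are taken to be nonzero, so that the test statistic is well defined (this is automatic if $n\lambda_n>1$). Let $\mathbb P_0$ and $\mathbb P_{I,\delta}$ denote the laws $\mathcal N_n(0,\Sigma_n)$ and $\mathcal N_n(\delta\mathbf 1_I,\Sigma_n)$ of $Y$. The type I and type II errors are $$\tilde\alpha(\Phi_n^{\mathrm d})=\mathbb P_0[\Phi_n^{\mathrm d}(Y)=1],\qquad \tilde\beta(\Phi_n^{\mathrm d})=\sup_{1\le k\le\lfloor\lambda_n^{-1}\rfloor}\ \sup_{|\delta|\ge\Delta_n}\mathbb P_{I_k,\delta}[\Phi_n^{\mathrm d}(Y)=0].$$ *)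

(* Defs.v *)
From HB Require Import structures.
From mathcomp Require Import all_boot all_order all_algebra.
From mathcomp Require Import all_classical all_reals all_analysis.

Set Implicit Arguments.
Unset Strict Implicit.
Unset Printing Implicit Defensive.

Import Order.TTheory GRing.Theory Num.Theory.
Import numFieldNormedType.Exports.

Local Open Scope classical_set_scope.
Local Open Scope ring_scope.

Definition posdefmx (R : realType) n (S : 'M[R]_n) : Prop :=
  S^T = S /\ forall v : 'cV[R]_n, v != 0 -> 0 < (v^T *m S *m v) 0 0.

(* Points of R^n are [n.-tuple]s, which carry the product sigma-algebra. *)
Definition tcol (R : realType) n (y : n.-tuple R) : 'cV[R]_n :=
  \col_i tnth y i.

(* N(m, v) with v the variance.  [normal_prob] takes the standard deviation,
   and [normal_prob m 0] is not the point mass at m. *)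
Definition normal_law (R : realType) (m v : R) : set R -> \bar R :=
  if v == 0 then dirac m else normal_prob m (Num.sqrt v).

(* P is N_n(mu, S): under P every linear form y |-> a^T y has the univariate
   law N(a^T mu, a^T S a). *)
Definition gaussian_law (R : realType) n (mu : 'cV[R]_n) (S : 'M[R]_n)
    (P : set (n.-tuple R) -> \bar R) : Prop :=
  forall (a : 'cV[R]_n) (A : set R), measurable A ->
    pushforward P (fun y => (a^T *m tcol y) 0 0) A =
    normal_law ((a^T *m mu) 0 0) ((a^T *m S *m a) 0 0) A.

Section process.
Context d (T : measurableType d) (R : realType) (Q : probability T R).

Definition joint m (X : 'I_m -> {RV Q >-> R}) (w : T) : m.-tuple R :=
  [tuple X i w | i < m].

Definition mean_col m (X : 'I_m -> {RV Q >-> R}) : 'cV[R]_m :=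
  \col_i fine 'E_Q[X i].

Definition cov_mx m (X : 'I_m -> {RV Q >-> R}) : 'M[R]_m :=
  \matrix_(i, j) fine (covariance Q (X i) (X j)).

Definition gaussian_process (X : nat -> {RV Q >-> R}) : Prop :=
  forall m (t : 'I_m -> nat),
    gaussian_law (mean_col (X \o t)) (cov_mx (X \o t))
      (pushforward Q (joint (X \o t))).

Definition stationary (X : nat -> {RV Q >-> R}) : Prop :=
  forall m (t : 'I_m -> nat) (h : nat) (A : set (m.-tuple R)), measurable A ->
    pushforward Q (joint (fun i => X (t i + h)%N)) A =
    pushforward Q (joint (X \o t)) A.

End process.

Section test.
Context (R : realType) (n : nat).
Implicit Types (I : set R) (S : 'M[R]_n) (lam alpha : R) (k : nat).

(* [i : 'I_n] starts at 0 and stands for the index i + 1 of 1, ..., n. *)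
Definition indic_col I : 'cV[R]_n :=
  \col_(i < n) \1_I (i.+1%:R / n%:R).

Definition block lam k : set R := `[k.-1%:R * lam, k%:R * lam[.

Definition blocks lam : set nat :=
  [set k | (1 <= k <= Num.truncn lam^-1)%N].

Definition sigt S lam k : R :=
  ((indic_col (block lam k))^T *m invmx S *m indic_col (block lam k)) 0 0.

Definition crit alpha lam : R := Num.sqrt (2 * ln (2 / (alpha * lam))).

Definition test_stat S lam (y : n.-tuple R) k : R :=
  `| ((indic_col (block lam k))^T *m invmx S *m tcol y) 0 0 |
  / Num.sqrt (sigt S lam k).

Definition Phi_d S alpha lam (y : n.-tuple R) : bool :=
  crit alpha lam < sup [set test_stat S lam y k | k in blocks lam].

Definition type_I (P0 : set (n.-tuple R) -> \bar R)
    (Phi : n.-tuple R -> bool) : \bar R :=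
  P0 [set y | Phi y = true].

Definition type_II lam (Delta : R) (P1 : nat -> R -> set (n.-tuple R) -> \bar R)
    (Phi : n.-tuple R -> bool) : \bar R :=
  ereal_sup [set ereal_sup [set P1 k delta [set y | Phi y = false]
                           | delta in [set delta | Delta <= `|delta|]]
            | k in blocks lam].

End test.

(* Main.v *)
Require Import Defs.
From HB Require Import structures.
From mathcomp Require Import all_boot all_order all_algebra.
From mathcomp Require Import all_classical all_reals all_analysis.
From mathcomp Require Import measurable_realfun lra.

Set Implicit Arguments.
Unset Strict Implicit.
Unset Printing Implicit Defensive.

Import Order.TTheory GRing.Theory Num.Theory.
Import numFieldNormedType.Exports.

Local Open Scope classical_set_scope.
Local Open Scope ring_scope.

(** Write [v] for the indicator column of a block and [sigma = v^T S^-1 v].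
The statistic of that block is the absolute value of the linear form
[y |-> b^T y] with [b = S^-1 v / sqrt sigma], the matched filter of [v].  This
scaling gives [b^T S b = 1] and [b^T (delta v) = delta sqrt sigma], so under a
Gaussian law with covariance [S] each statistic is the absolute value of a
normal variable of variance 1, centred at 0 under the null hypothesis and at
[delta sqrt sigma] under the alternative ([test_stat_law]).

Type I error.  The maximum over the blocks exceeds the critical value [c] iff
one statistic does ([Phi_d_set]), and each does so with probability at most
[2 exp (- c^2 / 2) = alpha lambda] ([normal_prob_tail], [crit_tail]).  There
are at most [1 / lambda] blocks, and the union bound gives [alpha].

Type II error.  If the test accepts, then the statistic of the block carrying
the signal is at most [c], that is, a normal variable with mean
[m = delta sqrt sigma] and variance 1 lies in [[- c, c]].  Its centred version
is then at distance at least [|m| - c] from 0 ([normal_prob_band]), and [|m|]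
is at least [Delta] times the infimum of the [sqrt sigma]. *)

(** * Inverting a positive definite matrix *)

Lemma posdefmx_unit (R : realType) n (S : 'M[R]_n) :
  posdefmx S -> S \in unitmx.
Proof.
move=> [_ Spos]; rewrite -row_free_unit -kermx_eq0; apply/eqP/row_matrixP => i.
rewrite row0; apply/eqP/contraT => ki0.
have := Spos (row i (kermx S))^T; rewrite -trmx0 (inj_eq trmx_inj) => /(_ ki0).
by rewrite trmxK -row_mul mulmx_ker row0 mul0mx mxE ltxx.
Qed.

(** With [w = S^-1 v], the form [v^T S^-1 v] equals [w^T S w]. *)
Lemma posdefmx_invmx_gt0 (R : realType) n (S : 'M[R]_n) (v : 'cV[R]_n) :
  posdefmx S -> v != 0 -> 0 < (v^T *m invmx S *m v) 0 0.
Proof.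
move=> Spd v0; have Su := posdefmx_unit Spd; case: Spd => Ssym Spos.
have := Spos (invmx S *m v).
rewrite trmx_mul trmx_inv Ssym -!mulmxA mulKVmx//; apply.
by apply: contra_neq v0 => w0; rewrite -(mulKVmx Su v) w0 mulmx0.
Qed.

(** * The matched filter *)

Section matched_filter.
Context (R : realType) (n : nat) (S : 'M[R]_n) (v : 'cV[R]_n).
Context (Spd : posdefmx S) (v0 : v != 0).
Let s := (v^T *m invmx S *m v) 0 0.

Definition filter_col : 'cV[R]_n :=
  (Num.sqrt ((v^T *m invmx S *m v) 0 0))^-1 *: (invmx S *m v).

Lemma tr_filter_col : filter_col^T = (Num.sqrt s)^-1 *: (v^T *m invmx S).
Proof. by rewrite /filter_col linearZ/= trmx_mul trmx_inv Spd.1. Qed.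

Lemma filter_colE (w : 'cV[R]_n) :
  (filter_col^T *m w) 0 0 = (v^T *m invmx S *m w) 0 0 / Num.sqrt s.
Proof. by rewrite tr_filter_col -scalemxAl mxE mulrC. Qed.

(** The factor [1 / sqrt s] in the filter is there to make this variance 1. *)
Lemma filter_col_var : (filter_col^T *m S *m filter_col) 0 0 = 1.
Proof.
have s0 : 0 < s by exact: posdefmx_invmx_gt0.
rewrite tr_filter_col /filter_col -!scalemxAl -scalemxAr mulmxKV ?posdefmx_unit//.
rewrite mulmxA 2!mxE -/s mulrA -invfM -expr2 sqr_sqrtr ?ltW//.
by rewrite mulVf ?gt_eqF.
Qed.

Lemma filter_col_mean (delta : R) :
  (filter_col^T *m (delta *: v)) 0 0 = delta * Num.sqrt s.
Proof.
have s0 : 0 < s by exact: posdefmx_invmx_gt0.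
rewrite filter_colE -scalemxAr mxE -/s -{1}(sqr_sqrtr (ltW s0)) expr2.
by rewrite mulrA mulfK ?gt_eqF ?sqrtr_gt0.
Qed.

Lemma gaussian_filter (mu : 'cV[R]_n) (P : set (n.-tuple R) -> \bar R)
    (A : set R) : gaussian_law mu S P -> measurable A ->
  P [set y | A ((filter_col^T *m tcol y) 0 0)] =
  normal_prob ((filter_col^T *m mu) 0 0) 1 A.
Proof.
move=> + mA => /(_ filter_col A mA).
by rewrite filter_col_var /normal_law oner_eq0 sqrtr1.
Qed.

End matched_filter.

Lemma measurable_linear_form (R : realType) n (a : 'cV[R]_n) :
  measurable_fun [set: n.-tuple R] (fun y => (a^T *m tcol y) 0 0).
Proof.
under eq_fun do rewrite mxE.
apply: measurable_sum => i; under eq_fun do rewrite !mxE.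
by apply: measurable_funM => //; exact: measurable_tnth.
Qed.

(** * Normal laws of variance 1 *)

(** Exponential tilting: the density of N(0,1) is that of N(m,1) times
[exp (m^2 / 2 - m z)], which is at most [exp (- m^2 / 2)] where
[m^2 <= m z]; the total mass of N(m,1) is 1. *)
Lemma normal_prob_tilt (R : realType) (m : R) (A : set R) :
  measurable A -> (forall z, A z -> m ^+ 2 <= m * z) ->
  (normal_prob 0 1 A <= (expR (- (m ^+ 2 / 2)))%:E)%E.
Proof.
move=> mA Am.
have mpdf (m' : R) :
    measurable_fun A (fun z => (normal_pdf m' 1 z)%:E).
  apply: measurable_funTS; apply/measurable_EFinP.
  exact: measurable_normal_pdf.
apply: (@le_trans _ _ ((expR (- (m ^+ 2 / 2)))%:E * normal_prob m 1 A)%E).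
  have pdf_ge0 m' z : A z -> (0 <= (normal_pdf m' 1 z)%:E)%E.
    by move=> _; rewrite lee_fin normal_pdf_ge0.
  rewrite /normal_prob -ge0_integralZl ?lee_fin ?expR_ge0//;
    [|exact: mpdf|exact: pdf_ge0].
  apply: ge0_le_integral => //=.
  - exact: pdf_ge0.
  - exact: mpdf.
  - by apply: measurable_funeM; exact: mpdf.
  - move=> z Az; rewrite -EFinM lee_fin !normal_pdfE ?oner_eq0//.
    rewrite mulrCA ler_wpM2l ?normal_peak_ge0// /normal_fun -expRD ler_expR.
    by have := Am z Az; rewrite expr1n subr0; nra.
rewrite muleC; apply: gee_pMl; rewrite ?lee_fin ?expR_ge0//.
  by rewrite fin_num_measure.
exact: probability_le1.
Qed.

Lemma measurable_norm_gt (R : realType) (c : R) :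
  measurable [set z : R | c < `|z|].
Proof.
have -> : [set z : R | c < `|z|] = setT `&` (@Num.norm R R) @^-1` `]c, +oo[.
  by rewrite setTI; apply/seteqP; split => z; rewrite /= in_itv/= andbT.
exact: normr_measurable.
Qed.

(** The upper tail is bounded by tilting to mean [c], the lower one by tilting
to mean [- c]. *)
Lemma normal_prob_tail (R : realType) (c : R) : 0 <= c ->
  (normal_prob 0 1 [set z : R | (c < `|z|)%R] <= (2 * expR (- (c ^+ 2 / 2)))%:E)%E.
Proof.
move=> c0.
have -> : [set z : R | c < `|z|] = `]c, +oo[ `|` `]-oo, (- c)[.
  by apply/seteqP; split => z; rewrite /= !in_itv/= andbT (ltrNr z) ltr_normr;
    [move/orP|move=> ?; apply/orP].
rewrite mulr_natl mulr2n EFinD.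
apply: le_trans (measureU2 _ _ _) _ => //; apply: leeD.
- apply: normal_prob_tilt => // z /=; rewrite in_itv/= andbT => cz.
  by rewrite expr2 ler_wpM2l// ltW.
- rewrite -(sqrrN c); apply: normal_prob_tilt => // z /=; rewrite in_itv/= => zc.
  by rewrite expr2 ler_wnM2l ?oppr_le0// ltW.
Qed.

(** Translation by [m]; the endpoints carry no mass.  Stated from a closed to
an open interval because this is how [normal_prob_band] obtains a strict
inequality. *)
Lemma normal_prob_shift (R : realType) (m a b : R) : a <= b ->
  normal_prob m 1 `[a + m, b + m] = normal_prob 0 1 `]a, b[.
Proof.
move=> ab; rewrite /normal_prob -(@integral_itv_bndoo _ a b _ true false); last first.
  by apply: measurable_funTS; apply/measurable_EFinP; exact: measurable_normal_pdf.
pose F (z : R) : R := z + m.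
have F'E : F^`()%classic = cst 1.
  by apply/funext => z; rewrite derive1E deriveD// derive_id derive_cst addr0.
have cF : continuous F by move=> z; apply: cvgD; [exact: cvg_id|exact: cvg_cst].
rewrite (@integration_by_substitution_increasing _ F)//.
- apply: eq_integral => z _; rewrite F'E !fctE mulr1 !normal_pdfE ?oner_eq0//.
  by rewrite /normal_fun /F addrK subr0.
- by move=> x y _ _; rewrite /F ltrD2r.
- by rewrite F'E => ? _; exact: cst_continuous.
- by rewrite F'E; exact: is_cvg_cst.
- by rewrite F'E; exact: is_cvg_cst.
- split.
  + by move=> z _; apply: derivableD.
  + by apply: cvg_at_right_filter; exact: cF.
  + by apply: cvg_at_left_filter; exact: cF.
- by apply: continuous_subspaceT; apply: continuous_normal_pdf; exact: oner_neq0.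
Qed.

(** If [|z + m| < c] then [|z| > |m| - c] by the triangle inequality.  Passing
to the open band is what makes the second inequality strict. *)
Lemma normal_prob_band (R : realType) (m c : R) : 0 <= c ->
  (normal_prob m 1 [set x : R | (`|x| <= c)%R]
   <= normal_prob 0 1 [set z | (`|m| - c < `|z|)%R])%E.
Proof.
move=> c0.
have -> : [set x : R | `|x| <= c] = `[(- c - m) + m, (c - m) + m]%classic.
  by apply/seteqP; split => x; rewrite /= !subrK in_itv/= ler_norml.
rewrite normal_prob_shift; last by rewrite lerD2r; lra.
apply: le_measure; rewrite ?inE//; first exact: measurable_norm_gt.
move=> z; rewrite /= in_itv/= => /andP[z1 z2].
have : `|z + m| < c by rewrite ltr_norml; apply/andP; split; lra.
have := ler_normB (z + m) z; rewrite addrC addKr; lra.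
Qed.

(** * The test *)

Section test_lemmas.
Context (R : realType) (n : nat) (S : 'M[R]_n) (lam alpha : R).

(** The supremum runs over finitely many statistics, so it is bounded, and it
exceeds the critical value iff one of them does.  The equality of events, rather than an
inclusion, also gives the measurability of the rejection region. *)
Lemma Phi_d_set : 0 < lam < 1 ->
  [set y : n.-tuple R | Phi_d S alpha lam y = true] =
  \bigcup_(i < Num.truncn lam^-1)
    [set y | crit alpha lam < test_stat S lam y i.+1].
Proof.
move=> /andP[lam0 lam1]; apply/seteqP; split=> y /=.
  move=> /sup_gt[|_ [k /andP[k1 kK] <-] ck].
    (* The supremum is over a nonempty set: [lam < 1] gives at least one block. *)
    exists (test_stat S lam y 1); exists 1%N => //=.
    by rewrite /blocks/= truncn_gt0 invf_ge1// ltW.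
  by exists k.-1 => /=; rewrite prednK.
move=> [i /= iK ci]; apply: (lt_le_trans ci); apply: ub_le_sup; last by exists i.+1.
(* The sum of the finitely many nonnegative statistics is an upper bound. *)
exists (\sum_(j < Num.truncn lam^-1) test_stat S lam y j.+1).
move=> _ [k /andP[k1 kK] <-].
have kK' : (k.-1 < Num.truncn lam^-1)%N by rewrite prednK.
rewrite (bigD1 (Ordinal kK'))//= prednK// lerDl sumr_ge0// => j _.
by rewrite divr_ge0 ?sqrtr_ge0.
Qed.

Lemma crit_ge0 : 0 <= crit alpha lam. Proof. exact: sqrtr_ge0. Qed.

(** The critical value is the one for which the Gaussian tail bound equals
[alpha * lam]. *)
Lemma crit_tail : 0 < alpha < 1 -> 0 < lam < 1 ->
  2 * expR (- (crit alpha lam ^+ 2 / 2)) = alpha * lam.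
Proof.
move=> /andP[a0 a1] /andP[l0 l1].
have al0 : 0 < alpha * lam by rewrite mulr_gt0.
have al1 : alpha * lam < 1 by rewrite mulr_ilt1// ltW.
have q1 : 1 <= 2 / (alpha * lam) by rewrite ler_pdivlMr// mul1r; lra.
rewrite sqr_sqrtr ?mulr_ge0 ?ln_ge0//.
rewrite [2 * ln _]mulrC mulfK// expRN lnK ?posrE ?(lt_le_trans ltr01)//.
by rewrite invf_div mulrC divfK.
Qed.

Context (Spd : posdefmx S).

Lemma test_stat_filter (y : n.-tuple R) k :
  test_stat S lam y k =
  `|((filter_col S (indic_col n (block lam k)))^T *m tcol y) 0 0|.
Proof.
rewrite filter_colE// normrM normfV.
by rewrite (ger0_norm (sqrtr_ge0 _)).
Qed.

Lemma measurable_test_stat_gt c k :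
  measurable [set y : n.-tuple R | c < test_stat S lam y k].
Proof.
under eq_set do rewrite test_stat_filter.
have := @measurable_linear_form R n (filter_col S (indic_col n (block lam k))).
by move=> /(_ measurableT _ (measurable_norm_gt c)); rewrite setTI.
Qed.

Lemma test_stat_law (mu : 'cV[R]_n) (P : set (n.-tuple R) -> \bar R) k
    (A : set R) :
  gaussian_law mu S P -> indic_col n (block lam k) != 0 ->
  measurable (@Num.norm R R @^-1` A) ->
  P [set y | A (test_stat S lam y k)] =
  normal_prob (((filter_col S (indic_col n (block lam k)))^T *m mu) 0 0) 1
    (@Num.norm R R @^-1` A).
Proof.
move=> Plaw v0 mA; under eq_set do rewrite test_stat_filter.
by rewrite -(gaussian_filter Spd v0 Plaw mA).
Qed.

End test_lemmas.

Theorem theorem2p2 (R : realType) (alpha : R) (alpha01 : 0 < alpha < 1)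
    (lambda Delta : nat -> R) (n : nat) (n_gt0 : (0 < n)%N)
    (lambda01 : 0 < lambda n < 1) (Delta_gt0 : 0 < Delta n)
    (d : measure_display) (T : measurableType d) (Q : probability T R)
    (X : nat -> {RV Q >-> R})
    (X_gaussian : gaussian_process X) (X_stationary : stationary X)
    (Sigma : 'M[R]_n) (SigmaE : Sigma = cov_mx (fun i : 'I_n => X i))
    (Sigma_posdef : posdefmx Sigma)
    (indic_neq0 : forall k : nat, blocks (lambda n) k ->
       indic_col n (block (lambda n) k) != 0)
    (P0 : probability (n.-tuple R) R)
    (P0_law : gaussian_law 0 Sigma P0)
    (P1 : nat -> R -> probability (n.-tuple R) R)
    (P1_law : forall (k : nat) (delta : R),
       blocks (lambda n) k -> Delta n <= `|delta| ->
       gaussian_law (delta *: indic_col n (block (lambda n) k)) Sigma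
         (P1 k delta)) :
  let Phi := Phi_d Sigma alpha (lambda n) in
  (type_I P0 Phi <= alpha%:E)%E /\
  (type_II (lambda n) (Delta n) (fun k delta => P1 k delta) Phi <=
   normal_prob 0 1
     [set z : R |
        (`|z| > Delta n * inf [set Num.sqrt (sigt Sigma (lambda n) k)
                              | k in blocks (lambda n)]
                - crit alpha (lambda n))%R])%E.
Proof.
move=> Phi.
set lam := lambda n in lambda01 indic_neq0 P1_law Phi *.
set c := crit alpha lam.
have c0 : 0 <= c by exact: crit_ge0.
have mgt k : measurable [set y : n.-tuple R | c < test_stat Sigma lam y k].
  exact: measurable_test_stat_gt.
split.
- rewrite /type_I (Phi_d_set _ _ lambda01) bigcup_mkord.
  apply: (le_trans (Boole_inequality P0 (fun i _ => mgt i.+1))) => /=.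
  apply: (@le_trans _ _ (\sum_(i < Num.truncn lam^-1) (alpha * lam)%:E)%E).
    apply: lee_sum => i _.
    rewrite -(crit_tail alpha01 lambda01).
    rewrite (test_stat_law Sigma_posdef (A := [set t | c < t]) P0_law).
    + by rewrite mulmx0 mxE; exact: normal_prob_tail.
    + by apply: indic_neq0; rewrite /blocks/=.
    + exact: measurable_norm_gt.
  rewrite sumEFin lee_fin sumr_const card_ord -[leRHS]mulr1 -mulrnAr.
  case/andP: alpha01 => a0 _; case/andP: lambda01 => l0 _.
  rewrite ler_wpM2l ?(ltW a0)// -mulr_natl -(ler_pdivlMr _ _ l0) div1r truncn_le.
  by rewrite invr_ge0 ltW.
- apply: ge_ereal_sup => _ [k kb <-]; apply: ge_ereal_sup => _ [delta hd <-].
  have law := P1_law _ _ kb hd.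
  (* Acceptance bounds every statistic by [c], in particular the one of the
     block that carries the signal. *)
  apply: (@le_trans _ _ (P1 k delta [set y | test_stat Sigma lam y k <= c])).
    apply: le_measure; rewrite ?inE.
    + have -> : [set y | Phi y = false] = ~` [set y | Phi y = true].
        by apply/seteqP; split => y /=; case: (Phi y).
      rewrite (Phi_d_set _ _ lambda01).
      by apply: measurableC; apply: bigcup_measurable.
    + have -> : [set y | test_stat Sigma lam y k <= c] =
                ~` [set y | c < test_stat Sigma lam y k].
        by apply/seteqP; split => y /=; rewrite leNgt => /negP.
      exact: measurableC.
    + move=> y /= PhiF; rewrite leNgt; apply/negP => ck.
      suff : Phi y = true by rewrite PhiF.
      have : [set y | Phi y = true] y; last by [].
      rewrite (Phi_d_set _ _ lambda01).
      case/andP: kb => k1 kK.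
      by exists k.-1 => /=; rewrite prednK.
  rewrite (test_stat_law Sigma_posdef (A := [set t | t <= c]) law).
  + rewrite filter_col_mean//; last exact: indic_neq0.
    apply: (le_trans (normal_prob_band _ c0)).
    apply: le_measure; rewrite ?inE; [exact: measurable_norm_gt..|].
    move=> z /=; apply: le_lt_trans; rewrite lerD2r normrM.
    rewrite (ger0_norm (sqrtr_ge0 _)).
    apply: ler_pM => //; first exact: ltW.
      apply: lb_le_inf; first by exists (Num.sqrt (sigt Sigma lam k)); exists k.
      by move=> _ [j _ <-]; exact: sqrtr_ge0.
    apply: ge_inf; last by exists k.
    by exists 0 => _ [j _ <-]; exact: sqrtr_ge0.
  + exact: indic_neq0.
  + rewrite (_ : _ @^-1` _ = ~` [set z | c < `|z|]).
      by apply: measurableC; exact: measurable_norm_gt.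
    by apply/seteqP; split => z /=; rewrite leNgt => /negP.
Qed.
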